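(* Suppose the random vector $(X,K_A)$ is regularly varying with index $\alpha>1$ and non-null Radon measure $\mu$. Let $(X_j)_{j\ge 1}$ be i.i.d. copies of $X$, independent of $(X,K_A)$, and let $H^{R}$ be a random variable with $$H^{R}\overset{d}{=} X\vee\bigvee_{j=1}^{K_A}X_j .$$ Then $$\mathbb{P}(H^{R}>x)\sim (1+\mathbb{E}[K_A])\,\mathbb{P}(X>x),\qquad x\to\infty .$$ Moreover, if $\mu(\{(x_1,x_2)\in[0,\infty)^2\setminus\{(0,0)\}: x_1>1\})>0$, then $H^{R}$ is regularly varying with index $\alpha$.
   Context: Setting (generic cluster of the renewal Poisson cluster process): $A$ is the random mark of an immigrant event, with values in a measurable space $\mathbb{A}$; $X=f(A)$ for a measurable $f:\mathbb{A}\to[0,\infty)$, so $X\ge 0$; $K_A$ is a random variable with values in $\{0,1,2,\dots\}$ (the number of offspring), which may depend on $X$. The offspring have transformed marks $X_j$. $H^R$ is the maximum of the transformed marks in a generic cluster. An empty maximum is omitted (if $K_A=0$ the maximum is $X$). Notation: $f(x)\sim g(x)$ as $x\to\infty$ means $\lim_{x\to\infty} f(x)/g(x)=1$. Regular variation: a nonnegative random variable $Z$ is regularly varying with index $\alpha>0$ if $\mathbb{P}(Z>x)=x^{-\alpha}L(x)$ for $x>0$, with $L$ slowly varying at infinity. A random vector $\mathbf{X}$ in $\mathbb{R}^2$ is regularly varying with index $\alpha>0$ and non-null Radon measure $\mu$ if (for some norm $|\cdot|$) $|\mathbf{X}|$ is regularly varying with index $\alpha$ and, for a sequence $(a_n)$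 with $n\mathbb{P}(|\mathbf{X}|>a_n)\to1$, the measures $n\mathbb{P}(a_n^{-1}\mathbf{X}\in\cdot)$ converge vaguely to $\mu$ on $\mathbb{R}^2\setminus\{(0,0)\}$, where $\mu$ is a non-null Radon measure (finite on Borel sets bounded away from the origin). *)

(* Defs.v *)
From HB Require Import structures.
From mathcomp Require Import all_boot all_order all_algebra finmap.
From mathcomp Require Import all_classical all_reals all_analysis.

Set Implicit Arguments.
Unset Strict Implicit.
Unset Printing Implicit Defensive.

Import Order.TTheory GRing.Theory Num.Theory.
Import numFieldNormedType.Exports.

Local Open Scope classical_set_scope.
Local Open Scope ring_scope.

Definition tail {d} {T : measurableType d} {R : realType}
    (P : probability T R) (Z : T -> R) (x : R) : \bar R :=
  P [set w | x < Z w].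

Definition eq_law {d1 d2 d} {T1 : measurableType d1} {T2 : measurableType d2}
    {S : measurableType d} {R : realType}
    (P1 : probability T1 R) (Z1 : T1 -> S)
    (P2 : probability T2 R) (Z2 : T2 -> S) : Prop :=
  forall B : set S, measurable B -> P1 (Z1 @^-1` B) = P2 (Z2 @^-1` B).

Definition generated_by {d d'} {T : measurableType d} {S : measurableType d'}
    (Z : T -> S) : set (set T) :=
  preimage_set_system setT Z measurable.

Definition mutually_independent {d} {T : measurableType d} {R : realType}
    (P : probability T R) {I : choiceType} (G : I -> set (set T)) : Prop :=
  forall (J : {fset I}) (E : I -> set T),
    (forall i, i \in J -> G i (E i)) ->
    P (\bigcap_(i in [set` J]) E i) = (\prod_(i <- J) P (E i))%E.

(* The quotient 0 / 0 is read as 1, so that two functions that are both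
   eventually zero are equivalent (X is allowed to be bounded).  If G x is
   infinite, or if G x is zero and F x is not, the quotient below is 0; this
   cannot happen for large x when F ~ G. *)
Definition asymp_equiv {R : realType} (F G : R -> \bar R) : Prop :=
  (if (F x == 0%E) && (G x == 0%E) then 1 else fine (F x) / fine (G x))
    @[x --> +oo] --> (1 : R).

Definition slowly_varying {R : realType} (L : R -> R) : Prop :=
  [/\ measurable_fun (`]0, +oo[ : set R) L,
      \forall x \near +oo, 0 < L x &
      forall t : R, 0 < t -> L (t * x) / L x @[x --> +oo] --> (1 : R)].

Definition regularly_varying_rv {d} {T : measurableType d} {R : realType}
    (P : probability T R) (Z : T -> R) (alpha : R) : Prop :=
  [/\ measurable_fun setT Z,
      {ae P, forall w, 0 <= Z w},
      0 < alpha &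
      exists2 L : R -> R, slowly_varying L &
        forall x : R, 0 < x -> tail P Z x = (x `^ (- alpha) * L x)%:E].

Definition is_norm {R : realType} (N : R * R -> R) : Prop :=
  [/\ forall u v, N (u + v) <= N u + N v,
      forall (c : R) v, N (c *: v) = `|c| * N v &
      forall v, N v = 0 -> v = 0].

(* `|z| is the maximum norm of R * R; all norms of the plane are equivalent,
   so the choice is immaterial. *)
Definition bounded_away_from_0 {R : realType} (B : set (R * R)) : Prop :=
  exists2 e : R, 0 < e & forall z, B z -> e <= `|z|.

(* A measure on the punctured plane is represented by its extension to the
   plane that gives no mass to the origin. *)
Definition radon_punctured {R : realType}
    (mu : {measure set (R * R) -> \bar R}) : Prop :=
  mu [set 0] = 0%E /\
  forall B, measurable B -> bounded_away_from_0 B -> (mu B < +oo)%E.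

Definition vague_test {R : realType} (phi : R * R -> R) : Prop :=
  [/\ continuous phi,
      forall z, 0 <= phi z,
      exists M : R, forall z, phi z <= M &
      bounded_away_from_0 [set z | phi z != 0]].

(* Vague convergence on the punctured plane, whose bounded sets are the sets
   bounded away from the origin. *)
Definition vague_cvg_punctured {R : realType}
    (nu : nat -> set (R * R) -> \bar R) (mu : set (R * R) -> \bar R) : Prop :=
  forall phi, vague_test phi ->
    (\int[nu n]_z (phi z)%:E)%E @[n --> \oo] --> (\int[mu]_z (phi z)%:E)%E.

Definition regularly_varying_vec {d} {T : measurableType d} {R : realType}
    (P : probability T R) (V : T -> R * R) (alpha : R)
    (mu : {measure set (R * R) -> \bar R}) : Prop :=
  [/\ measurable_fun setT V,
      radon_punctured mu,
      mu setT != 0%E &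
      exists2 N : R * R -> R, is_norm N &
        regularly_varying_rv P (N \o V) alpha /\
        exists2 a : nat -> R,
          (n%:R%:E * tail P (N \o V) (a n))%E @[n --> \oo] --> 1%E &
          vague_cvg_punctured
            (fun n B => n%:R%:E * P [set w | B ((a n)^-1 *: V w)])%E mu].

Definition cluster_max {T : Type} {R : realType}
    (X : T -> R) (K : T -> nat) (Xs : nat -> T -> R) (w : T) : R :=
  \big[Num.max/X w]_(j < K w) Xs j w.

(* Main.v *)
Require Import Defs.
From HB Require Import structures.
From mathcomp Require Import all_boot all_order all_algebra finmap.
From mathcomp Require Import all_classical all_reals all_analysis.
From mathcomp Require Import measurable_realfun ring lra.
Import Order.TTheory GRing.Theory Num.Theory.
Import numFieldNormedType.Exports.

Local Open Scope classical_set_scope.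
Local Open Scope ring_scope.

(** Write p(x) = P(X > x) and F = 1 - p.  Given the immigrant, the cluster
    maximum stays below x exactly when X <= x and each of the K independent
    offspring marks does, so P(H <= x) = E[1(X <= x) F(x)^K].  Complementing,
    and factoring 1 - F^K = p (1 + F + ... + F^(K-1)), gives the exact identity
      P(H > x) = p(x) (1 + e(x)),
      e(x) = E[1(X <= x) (1 + F(x) + ... + F(x)^(K-1))]
    ([tail_cluster_max]).  As x grows, the integrand tends to K and stays
    below K, so e(x) -> E[K] by dominated convergence as soon as E[K] is finite
    ([offspring_factor_cvg]).  The dependence between X and K is harmless
    because it only enters through the indicator of X <= x, which tends to 1.

    Finiteness of E[K] is where the index alpha > 1 enters.  The norm N(X, K) is
    regularly varying with index alpha, so at high levels its tail is divided by
    some fixed factor larger than 2 whenever the level doubles; summing over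
    dyadic levels bounds its mean by a convergent geometric series
    ([regvar_mean_lty]).  Any norm of the plane dominates a multiple of the second
    coordinate ([planar_norm_ge_snd]).

    For the second claim it remains to see that p is regularly varying, since
    1 + e(x) has a positive limit.  Let U be the tail of N(X, K), with norming
    sequence a_n.  Testing the vague convergence against a single continuous
    ramp in the first coordinate, which vanishes below 1 and equals 1 above
    eta > 1, yields a limit J with, asymptotically,
      n p(eta a_n) <= J <= n p(a_n),
    and J > 0 because mu charges the half plane of first coordinates above 1.
    Replacing n by the integer part of 1 / U(y) turns these bounds along a_n into
    bounds at every large level x: up to powers of eta, the quotient p / U is
    eventually bounded by the same J on both sides ([tail_quotient_ge],
    [tail_quotient_le]).  A positive function that is eventually confined to
    intervals of ratio arbitrarily close to 1 is slowly varying
    ([ratio_cvg1_of_bounds]), so p inherits the index of U. *)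

(** * Powers *)

Lemma gt1_ltr_powR (R : realType) (a r s : R) : 1 < a -> r < s -> a `^ r < a `^ s.
Proof.
move=> a1 rs; rewrite /powR gt_eqF ?(lt_trans ltr01) // ltr_expR.
by rewrite ltr_pM2r // ln_gt0.
Qed.

Lemma powRVl (R : realType) (a r : R) : 0 <= a -> a^-1 `^ r = (a `^ r)^-1.
Proof. by move=> a0; rewrite -powR_inv1 // -powRrM mulN1r powRN. Qed.

(** * Tails of random variables *)

Definition rtail {d} {T : measurableType d} {R : realType}
    (P : probability T R) (Z : T -> R) (x : R) : R := fine (tail P Z x).

Section Tails.
Context {d} {T : measurableType d} {R : realType} (P : probability T R).
Context (Z : T -> R) (mZ : measurable_fun setT Z).

Lemma measurable_exceed x : measurable [set w | x < Z w].
Proof.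
rewrite (_ : [set w | _] = Z @^-1` `]x, +oo[); last first.
  by apply/seteqP; split => w /=; rewrite in_itv /= andbT.
by rewrite -[X in measurable X]setTI; exact: mZ.
Qed.

Lemma measurable_not_exceed x : measurable [set w | Z w <= x].
Proof.
rewrite (_ : [set w | _] = Z @^-1` `]-oo, x]); last first.
  by apply/seteqP; split => w /=; rewrite in_itv.
by rewrite -[X in measurable X]setTI; exact: mZ.
Qed.

Lemma tailE x : tail P Z x = (rtail P Z x)%:E.
Proof. by rewrite /rtail fineK // fin_num_measure //; exact: measurable_exceed. Qed.

Lemma rtail_ge0 x : 0 <= rtail P Z x.
Proof. exact: fine_ge0. Qed.

Lemma rtail_le1 x : rtail P Z x <= 1.
Proof. by rewrite -lee_fin -tailE probability_le1 //; exact: measurable_exceed. Qed.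

Lemma rtail_nincr x y : x <= y -> rtail P Z y <= rtail P Z x.
Proof.
move=> xy; rewrite -lee_fin -!tailE; apply: le_measure.
- by rewrite inE; exact: measurable_exceed.
- by rewrite inE; exact: measurable_exceed.
- by move=> w /=; exact: le_lt_trans.
Qed.

Lemma rtail_gt0 x : (\forall y \near +oo, 0 < rtail P Z y) -> 0 < rtail P Z x.
Proof.
move=> [M [_ hM]]; apply: (lt_le_trans (hM (Num.max x (M + 1)) _)).
  by rewrite lt_max ltrDl ltr01 orbT.
by apply: rtail_nincr; rewrite le_max lexx.
Qed.

Lemma rtail_cvg0 : rtail P Z x @[x --> +oo] --> 0.
Proof.
pose ZM : {mfun T >-> R} := mfun_Sub (mem_set mZ : Z \in mfun).
have tailccdf x : tail P Z x = ccdf (P := P) ZM x.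
  rewrite /tail /ccdf /distribution /pushforward; congr (P _).
  by apply/seteqP; split => w /=; rewrite in_itv /= andbT.
apply: fine_cvg.
rewrite (_ : tail P Z = ccdf (P := P) ZM); last exact/funext.
exact: cvg_ccdfy0.
Qed.

End Tails.

(** * Regular variation expressed by ratios of tails *)

Section RegularVariation.
Context {d} {T : measurableType d} {R : realType} (P : probability T R).
Context (Z : T -> R) (alpha : R) (rvZ : regularly_varying_rv P Z alpha).

Lemma regvar_rtail_gt0 : \forall x \near +oo, 0 < rtail P Z x.
Proof.
have [mZ _ _ [L [_ L0 _] LE]] := rvZ.
near=> x.
have x0 : 0 < x by near: x; exact: nbhs_pinfty_gt.
rewrite /rtail LE //= mulr_gt0 ?powR_gt0 //.
by near: x.
Unshelve. all: by end_near. Qed.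

Lemma regvar_rtail_ratio t : 0 < t ->
  rtail P Z (t * x) / rtail P Z x @[x --> +oo] --> t `^ (- alpha).
Proof.
move=> t0; have [mZ _ _ [L [_ L0 Lt] LE]] := rvZ.
have : t `^ (- alpha) * (L (t * x) / L x) @[x --> +oo] --> t `^ (- alpha) * 1.
  by apply: cvgM; [exact: cvg_cst | exact: Lt].
rewrite mulr1; apply: cvg_trans; apply: near_eq_cvg; near=> x.
have x0 : 0 < x by near: x; exact: nbhs_pinfty_gt.
have Lx0 : 0 < L x by near: x.
rewrite /rtail !LE ?mulr_gt0 //= powRM ?ltW //.
have xa0 : x `^ (- alpha) != 0 by rewrite gt_eqF ?powR_gt0.
by field; rewrite xa0 gt_eqF.
Unshelve. all: by end_near. Qed.

End RegularVariation.

(** The slowly varying part is recovered as [x ^ alpha * P (Z > x)]; it is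
    measurable because tails are monotone. *)
Lemma regularly_varying_of_ratio d (T : measurableType d) (R : realType)
    (P : probability T R) (Z : T -> R) (alpha : R) :
  measurable_fun setT Z -> {ae P, forall w, 0 <= Z w} -> 0 < alpha ->
  (\forall x \near +oo, 0 < rtail P Z x) ->
  (forall t, 0 < t ->
    rtail P Z (t * x) / rtail P Z x @[x --> +oo] --> t `^ (- alpha)) ->
  regularly_varying_rv P Z alpha.
Proof.
move=> mZ Z0 alpha0 tail_gt0 tail_ratio; split => //.
exists (fun x => x `^ alpha * rtail P Z x); last first.
  move=> x x0; rewrite tailE // mulrA -powRD; last by rewrite (gt_eqF x0) implybT.
  by rewrite addNr powRr0 mul1r.
split.
- apply: measurable_funM; first by apply: measurable_funTS; exact: measurable_powR.
  apply: nonincreasing_measurable; first exact: measurable_itv.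
  by move=> x y *; exact: rtail_nincr.
- near=> x; rewrite mulr_gt0 //; last by near: x.
  by rewrite powR_gt0 //; near: x; exact: nbhs_pinfty_gt.
- move=> t t0.
  suff : t `^ alpha * (rtail P Z (t * x) / rtail P Z x) @[x --> +oo] -->
      t `^ alpha * t `^ (- alpha).
    rewrite powRN divff ?gt_eqF ?powR_gt0 //.
    apply: cvg_trans; apply: near_eq_cvg; near=> x.
    have x0 : 0 < x by near: x; exact: nbhs_pinfty_gt.
    have px : 0 < rtail P Z x by near: x.
    rewrite powRM ?ltW //; field.
    by rewrite !gt_eqF ?powR_gt0.
  by apply: cvgM; [exact: cvg_cst | exact: tail_ratio].
Unshelve. all: by end_near. Qed.

(** Once [q] stays between [J] and [k * J], both at [x] and at [t * x], the ratio
    stays between [1 / k] and [k], and [k] is as close to 1 as desired. *)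
Lemma ratio_cvg1_of_bounds (R : realType) (q : R -> R) (t : R) :
  0 < t ->
  (forall k : R, 1 < k ->
    exists2 J : R, 0 < J & \forall x \near +oo, J <= q x <= k * J) ->
  q (t * x) / q x @[x --> +oo] --> (1 : R).
Proof.
move=> t0 bounds; apply/cvgrPdist_le => eps eps0.
have k1 : 1 < 1 + eps by lra.
have [J J0 qJ] := bounds _ k1.
have qtJ : \forall x \near +oo, J <= q (t * x) <= (1 + eps) * J.
  have [M [_ hM]] := qJ; exists (t^-1 * M); split; first exact: num_real.
  by move=> x; rewrite ltr_pdivrMl //; exact: hM.
near=> x.
have /andP[q1 q2] : J <= q x <= (1 + eps) * J by near: x.
have /andP[q3 q4] : J <= q (t * x) <= (1 + eps) * J by near: x.
have q0 : 0 < q x by exact: lt_le_trans q1.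
have up : q (t * x) / q x <= 1 + eps by rewrite ler_pdivrMr //; nra.
have lo : 1 - eps <= q (t * x) / q x by rewrite ler_pdivlMr //; nra.
by rewrite ler_norml; apply/andP; split; lra.
Unshelve. all: by end_near. Qed.

Lemma ratio_cvg_mul (R : realType) (q r : R -> R) (c l t : R) :
  0 < t -> 0 < c -> r x @[x --> +oo] --> c ->
  q (t * x) / q x @[x --> +oo] --> l ->
  (q (t * x) * r (t * x)) / (q x * r x) @[x --> +oo] --> l.
Proof.
move=> t0 c0 rc ql.
have rtc : r (t * x) @[x --> +oo] --> c.
  apply/cvgrPdist_lt => eps eps0.
  have [M [_ hM]] := cvgr_dist_lt _ _ rc _ eps0.
  exists (t^-1 * M); split; first exact: num_real.
  by move=> x; rewrite ltr_pdivrMl //; exact: hM.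
suff : q (t * x) / q x * (r (t * x) / r x) @[x --> +oo] --> l * (c / c).
  rewrite divff ?gt_eqF // mulr1; apply: cvg_trans; apply: near_eq_cvg.
  by apply: nearW => x; rewrite invfM mulrACA.
by apply: cvgM => //; apply: cvgM => //; apply: cvgV; rewrite ?gt_eqF.
Qed.

(** * Finite means *)

(** With [x0] chosen so that doubling any level above [x0] multiplies the tail by
    at most [rho < 1 / 2], the dyadic sum of [2 ^ k * x0 * P (Z > 2 ^ k * x0)],
    which bounds the mean of [Z] up to [x0], is dominated by a geometric series of
    ratio [2 * rho]. *)
Lemma regvar_mean_lty d (T : measurableType d) (R : realType)
    (P : probability T R) (Z : T -> R) (alpha : R) :
  (forall w, 0 <= Z w) -> 1 < alpha -> regularly_varying_rv P Z alpha ->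
  (\int[P]_w (Z w)%:E < +oo)%E.
Proof.
move=> Z0 a1 rvZ; have [mZ _ _ _] := rvZ.
set U := rtail P Z.
have rho_half : (2 : R) `^ (- alpha) < 2^-1.
  by rewrite -[X in _ < X]powR_inv1 // gt1_ltr_powR //; lra.
pose rho : R := ((2 : R) `^ (- alpha) + 2^-1) / 2.
have a2 : 0 <= (2 : R) `^ (- alpha) by exact: powR_ge0.
have rho_gt0 : 0 < rho by rewrite /rho; lra.
have rho_lt : 2 * rho < 1 by rewrite /rho; lra.
have [x0 x0_gt0 Udouble] : exists2 x0 : R, 0 < x0 &
    forall x, x0 <= x -> U (2 * x) <= rho * U x.
  have h1 : \forall x \near +oo, U (2 * x) / U x <= rho.
    apply: cvgr_le (regvar_rtail_ratio _ _ _ rvZ 2 _) _ _ => //.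
    by rewrite /rho; lra.
  have h2 := regvar_rtail_gt0 _ _ _ rvZ.
  have [M [_ hM]] : \forall x \near +oo, U (2 * x) <= rho * U x.
    near=> x; rewrite -ler_pdivrMr; last by near: x.
    by near: x.
  exists (Num.max 1 (M + 1)) => [|x]; first by rewrite lt_max ltr01.
  by rewrite ge_max => /andP[_ Mx]; apply: hM; lra.
have Ugeo k : U (2 ^+ k * x0) <= rho ^+ k.
  elim: k => [|k IH]; first by rewrite !expr0 mul1r rtail_le1.
  rewrite exprS -mulrA (le_trans (Udouble _ _)) //.
    by rewrite ler_peMl ?exprn_ege1 ?ler1n // ltW.
  by rewrite exprS ler_pM2l.
pose B k := [set w | 2 ^+ k * x0 < Z w].
have mB k : measurable (B k) by exact: measurable_exceed.
pose g k w : \bar R := ((2 ^+ k * x0)%:E * (\1_(B k) w)%:E)%E.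
have g0 k w : (0 <= g k w)%E.
  by rewrite /g -EFinM lee_fin !mulr_ge0 ?exprn_ge0 // ltW.
have mg k : measurable_fun [set: T] (g k).
  apply: emeasurable_funM; first exact: measurable_cst.
  exact/measurable_EFinP/measurable_indic.
(* doubling the cap 2^n x0 adds at most 2^n x0, and only when Z exceeds the cap *)
have truncE n w : Num.min (Z w) (2 ^+ n * x0) <=
    x0 + \sum_(0 <= k < n) 2 ^+ k * x0 * \1_(B k) w.
  elim: n => [|n IH].
    by rewrite big_nil expr0 mul1r addr0 ge_min lexx orbT.
  rewrite big_nat_recr //= indicE.
  have [wB|wB] := boolP (w \in B n).
    rewrite mulr1 exprS; move: IH; have /set_mem /= := wB.
    set s := \sum_(_ <= _ < _) _; set y := 2 ^+ n * x0 => yZ.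
    rewrite min_r; last exact: ltW.
    rewrite -mulrA -/y => ys; rewrite ge_min; apply/orP; right; lra.
  rewrite mulr0 addr0; apply: le_trans IH.
  have ZB : Z w <= 2 ^+ n * x0.
    by rewrite leNgt; apply/negP => h; move/negP: wB; apply; rewrite inE.
  by rewrite min_l ?min_l // exprS -mulrA (le_trans ZB) // ler_peMl ?ler1n //
    mulr_ge0 ?exprn_ge0 ?ltW.
have pointwise w : ((Z w)%:E <= x0%:E + \sum_(0 <= k <oo) g k w)%E.
  have [n Zn] : exists n, Z w <= 2 ^+ n * x0.
    pose m := Num.truncn (Z w / x0).
    exists m.+1; rewrite -ler_pdivrMr //.
    rewrite (le_trans (ltW (truncnS_gt _))) // -natrX ler_nat.
    by rewrite ltnW // ltn_expl.
  apply: (@le_trans _ _ (x0%:E + \sum_(0 <= k < n) g k w)%E).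
    rewrite /g; under eq_bigr do rewrite -EFinM.
    by rewrite sumEFin -EFinD lee_fin -{1}(min_l Zn) truncE.
  by rewrite leeD2l // nneseries_lim_ge.
apply: (@le_lt_trans _ _ (\int[P]_w (x0%:E + \sum_(0 <= k <oo) g k w)))%E.
  apply: ge0_le_integral => //=.
  - by move=> w _; rewrite lee_fin.
  - exact/measurable_EFinP.
  - apply: emeasurable_funD => //; apply: ge0_emeasurable_sum => //.
rewrite ge0_integralD //=; last 3 first.
- by move=> w _; rewrite lee_fin ltW.
- by move=> w _; apply: nneseries_ge0.
- by apply: ge0_emeasurable_sum.
have -> : (\int[P]_w x0%:E = x0%:E)%E.
  by rewrite integral_cst // -[RHS]mule1; congr (_ * _)%E; exact: probability_setT.
rewrite integral_nneseries //.
have gint k : (\int[P]_w g k w = (2 ^+ k * x0 * U (2 ^+ k * x0))%:E)%E.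
  rewrite ge0_integralZl //=; last 2 first.
  - exact/measurable_EFinP/measurable_indic.
  - by rewrite lee_fin mulr_ge0 ?exprn_ge0 ?ltW.
  by rewrite integral_indic // setIT [RHS]EFinM /U -tailE.
apply: (@le_lt_trans _ _ (x0%:E + (x0 / (1 - 2 * rho))%:E)%E); last first.
  by rewrite -EFinD ltry.
rewrite leeD2l //; apply: lime_le.
  by apply: is_cvg_nneseries => k _ _; apply: integral_ge0.
apply: nearW => n; under eq_bigr do rewrite gint.
rewrite sumEFin lee_fin.
apply: le_trans (geometric_le_lim n (ltW x0_gt0) _ _).
- rewrite /series /=; apply: ler_sum => k _.
  rewrite /geometric /= exprMn (_ : x0 * _ = 2 ^+ k * x0 * rho ^+ k); last by ring.
  by rewrite ler_pM2l ?mulr_gt0 ?exprn_gt0.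
- by rewrite mulr_gt0.
- by rewrite ger0_norm // mulr_ge0 // ltW.
Unshelve. all: by end_near. Qed.

(** * Norms of the plane *)

Section PlanarNorm.
Context {R : realType} (N : R * R -> R) (normN : is_norm N).

Let scale_pairE (c x y : R) : c *: ((x, y) : R * R) = (c * x, c * y).
Proof. by []. Qed.

Let add_pairE (x y x' y' : R) : (x, y) + (x', y') = (x + x', y + y').
Proof. by []. Qed.

Lemma planar_norm_ge0 v : 0 <= N v.
Proof.
have [tri hom _] := normN.
have := tri v (- 1 *: v); rewrite hom normrN normr1 mul1r scaleN1r subrr.
by rewrite -(scale0r v) hom normr0 mul0r; lra.
Qed.

(** By homogeneity it suffices to bound [N] from below on the horizontal line at
    height 1.  There [N] is continuous and grows linearly in both directions, so
    its infimum is attained, hence positive. *)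
Lemma planar_norm_ge_snd : exists2 c : R, 0 < c & forall x y, c * `|y| <= N (x, y).
Proof.
have [tri hom sep] := normN.
pose h (t : R) := N (t, 1).
have h_gt0 t : 0 < h t.
  rewrite lt_neqAle planar_norm_ge0 andbT eq_sym; apply/eqP => /sep [_ /eqP].
  by rewrite oner_eq0.
pose e := N (1, 0).
have e_gt0 : 0 < e.
  rewrite lt_neqAle planar_norm_ge0 andbT eq_sym; apply/eqP => /sep [/eqP].
  by rewrite oner_eq0.
have hlip s t : h s <= h t + `|s - t| * e.
  rewrite /h /e -hom (_ : (s, 1) = (t, 1) + (s - t) *: ((1, 0) : R * R)) //.
  by rewrite scale_pairE add_pairE; congr pair; ring.
have hcont : continuous h.
  move=> s; apply/cvgrPdist_lt => eps eps0; near=> t.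
  have ts : `|s - t| < eps / e.
    by near: t; apply: cvgr_dist_lt => //; exact: divr_gt0.
  have tse : `|s - t| * e < eps by rewrite -ltr_pdivlMr.
  have := hlip s t; have := hlip t s; rewrite (distrC t s) => h1 h2.
  by rewrite ltr_norml; apply/andP; split; lra.
pose M := 2 * h 0 / e.
have M0 : 0 <= M by rewrite /M divr_ge0 // ?mulr_ge0 // ltW.
have [t0 _ t0min] := @EVT_min R h (- M) M ltac:(lra)
  (continuous_subspaceT hcont).
(* outside of [- M, M] linear growth already gives h t >= h 0 *)
pose c := Num.min (h t0) (h 0).
have c_le t : c <= h t.
  have [tM|tM] := leP `|t| M.
    by rewrite /c ge_min t0min // in_itv /= -ler_norml.
  rewrite /c ge_min; apply/orP; right.
  have : `|t| * e <= h t + h 0.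
    rewrite /h /e -hom.
    have := tri (t, 1) (- 1 *: ((0, 1) : R * R)); rewrite (hom (- 1)) normrN normr1 mul1r.
    rewrite (_ : (t, 1) + _ = t *: ((1, 0) : R * R)) //.
    by rewrite !scale_pairE add_pairE; congr pair; ring.
  by move: tM; rewrite /M ltr_pdivrMr //; lra.
exists c => [|x y]; first by rewrite /c lt_min !h_gt0.
have [->|y0] := eqVneq y 0; first by rewrite normr0 mulr0 planar_norm_ge0.
rewrite (_ : (x, y) = y *: ((x / y, 1) : R * R)); last first.
  by rewrite scale_pairE mulr1 mulrC divfK.
by rewrite hom mulrC ler_pM2l ?normr_gt0 // c_le.
Unshelve. all: by end_near. Qed.

End PlanarNorm.

(** * The tail of the cluster maximum *)

Section ClusterTail.
Context {R : realType} {d} {T : measurableType d} (P : probability T R).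
Context (X : T -> R) (mX : measurable_fun setT X) (K : {RV P >-> nat}).
Context (Xs : nat -> {RV P >-> R}) (Xs_copy : forall j, eq_law P (Xs j) P X).
Context (indep : mutually_independent P (fun i : option nat =>
       if i is Some j then generated_by (Xs j)
       else generated_by (fun w => (X w, K w)))).

Local Notation C := (cluster_max X K Xs).
Local Notation p := (rtail P X).

Lemma cluster_max_leP w x : (C w <= x) <-> X w <= x /\ forall j, (j < K w)%N -> Xs j w <= x.
Proof.
rewrite /cluster_max; split=> [/bigmax_leP[Xx h]|[Xx h]].
  by split=> // j jK; exact: (h (Ordinal jK)).
by apply/bigmax_leP; split=> // j _; exact: h.
Qed.

Lemma measurable_offspring_eq k : measurable [set w | K w = k].
Proof.
rewrite (_ : [set w | _] = K @^-1` [set k]) //.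
by rewrite -[X in measurable X]setTI; exact: measurable_funPT.
Qed.

Lemma prob_not_exceed x : P [set w | X w <= x] = (1 - p x)%:E.
Proof.
rewrite (_ : [set w | X w <= x] = ~` [set w | x < X w]); last first.
  by apply/seteqP; split => w /=; rewrite leNgt => /negP.
by rewrite probability_setC -/(tail P X x) ?tailE //; exact: measurable_exceed.
Qed.

Lemma prob_copy_not_exceed j x : P [set w | Xs j w <= x] = (1 - p x)%:E.
Proof.
rewrite -prob_not_exceed.
have := Xs_copy j `]-oo, x]%classic (measurable_itv _).
by congr (P _ = P _); apply/seteqP; split => w /=; rewrite in_itv.
Qed.

(** On [K = k] only the first [k] offspring matter, so independence applies to the
    finite family made of the immigrant, indexed by [None], and of the offspring
    [Some 0, ..., Some (k - 1)]. *)
Lemma prob_cluster_max_le_given k x :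
  P [set w | [/\ X w <= x, K w = k & forall j, (j < k)%N -> Xs j w <= x]] =
  (P ([set w | (X w <= x)%R] `&` [set w | K w = k]) * ((1 - p x) ^+ k)%:E)%E.
Proof.
pose s := None :: map Some (iota 0 k).
have us : uniq s.
  rewrite /s /= map_inj_uniq ?iota_uniq ?andbT; last by move=> ? ? [].
  by apply/mapP => -[].
pose J : {fset option nat} := [fset i in s]%fset.
pose E (i : option nat) := if i is Some j then [set w | Xs j w <= x]
  else [set w | X w <= x] `&` [set w | K w = k].
have := indep J E.
have -> : \bigcap_(i in [set` J]) E i =
    [set w | [/\ X w <= x, K w = k & forall j, (j < k)%N -> Xs j w <= x]].
  apply/seteqP; split=> w /=.
    move=> h; have [] : E None w by apply: h; rewrite /= !inE.
    move=> Xx Kk; split=> // j jk.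
    apply: (h (Some j)); rewrite /= !inE /=; apply/mapP; exists j => //.
    by rewrite mem_iota.
  move=> [Xx Kk h] [j|] //=; rewrite !inE /= => /mapP[i].
  by rewrite mem_iota /= add0n => ik [->]; exact: h.
have -> : (\prod_(i <- J) P (E i) = \prod_(i <- s) P (E i))%E.
  apply: perm_big; apply: uniq_perm => // i; by rewrite !inE.
rewrite /s big_cons big_map /= => ->.
- congr (_ * _)%E.
  under eq_bigr do rewrite prob_copy_not_exceed.
  by rewrite prodEFin big_const_seq count_predT size_iota iter_mulr_1.
- move=> [j|] _; rewrite /generated_by /preimage_set_system /=.
    exists (`]-oo, x]%classic) => //.
    by rewrite setTI; apply/seteqP; split => w /=; rewrite in_itv.
  exists (`]-oo, x]%classic `*` [set k]); first exact: measurableX.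
  by rewrite setTI; apply/seteqP; split => w /=; rewrite in_itv.
Qed.

Lemma measurable_offspring_fun (h : nat -> R) : measurable_fun setT (h \o K).
Proof. by apply: measurableT_comp => //; exact: measurable_funPT. Qed.

(** Summing over the values of [K] turns the powers [F ^ k] into the expectation
    of [F ^ K], the generating function of [K] at [F] restricted to [X <= x]. *)
Lemma prob_cluster_max_le x : (P [set w | (C w <= x)%R] =
  \int[P]_w (\1_[set w | (X w <= x)%R] w * (1 - p x) ^+ K w)%:E)%E.
Proof.
have F0 : 0 <= 1 - p x by rewrite subr_ge0 rtail_le1.
pose A k := [set w | [/\ X w <= x, K w = k & forall j, (j < k)%N -> Xs j w <= x]].
have mA k : measurable (A k).
  rewrite (_ : A k = [set w | X w <= x] `&` [set w | K w = k] `&`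
      \bigcap_(j in `I_k) [set w | Xs j w <= x]); last first.
    by apply/seteqP; split=> w /= => [[? ? ?]|[[? ?] ?]].
  apply: measurableI.
    apply: measurableI; [exact: measurable_not_exceed | exact: measurable_offspring_eq].
  apply: bigcap_measurableType => j _.
  by apply: measurable_not_exceed; exact: measurable_funPT.
have -> : [set w | C w <= x] = \bigcup_k A k.
  apply/seteqP; split=> w /=.
    by move=> /cluster_max_leP[? ?]; exists (K w).
  by move=> [k _ [? <- ?]]; apply/cluster_max_leP.
rewrite measure_bigcup //; last first.
  by move=> i j _ _ [w [[_ <- _] [_ <- _]]].
pose B k := [set w | K w = k].
have BT : \bigcup_k B k = setT by apply/seteqP; split=> // w _; exists (K w).
rewrite -BT ge0_integral_bigcup //; last 4 first.
- by move=> k; exact: measurable_offspring_eq.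
- rewrite BT; apply/measurable_EFinP; apply: measurable_funM.
    by apply: measurable_indic; exact: measurable_not_exceed.
  exact: (measurable_offspring_fun (fun k => (1 - p x) ^+ k)).
- by move=> w _; rewrite lee_fin mulr_ge0 ?exprn_ge0.
- by move=> i j _ _ [w [<- <-]].
rewrite (eq_eseriesl _ (Q := xpredT)); last by move=> k; rewrite in_setT.
apply: eq_eseriesr => k _; transitivity (P ([set w | (X w <= x)%R] `&` B k) * ((1 - p x) ^+ k)%:E)%E;
  first exact: prob_cluster_max_le_given.
under eq_integral => w /set_mem /= -> do rewrite mulrC EFinM.
rewrite ge0_integralZl //=; last 3 first.
- exact: measurable_offspring_eq.
- apply/measurable_EFinP; apply: measurable_funTS; apply: measurable_indic.
  exact: measurable_not_exceed.
- by rewrite lee_fin exprn_ge0.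
rewrite integral_indic //; [|exact: measurable_offspring_eq|exact: measurable_not_exceed].
by rewrite muleC.
Qed.

(** On [X <= x] the sum is [(1 - F ^ K) / p] with [F = 1 - p], written as a
    polynomial so that it keeps a meaning when [p] vanishes. *)
Definition offspring_factor x : \bar R :=
  (\int[P]_w (\1_[set w | (X w <= x)%R] w * \sum_(i < K w) (1 - p x) ^+ i)%:E)%E.

(** Complementing [prob_cluster_max_le] and factoring
    [1 - F ^ k = p * (1 + F + ... + F ^ (k - 1))] isolates the tail of [X]. *)
Lemma tail_cluster_max x : (tail P C x = (p x)%:E * (1 + offspring_factor x))%E.
Proof.
have F0 : 0 <= 1 - p x by rewrite subr_ge0 rtail_le1.
have p0 := rtail_ge0 P X x.
have mI : measurable_fun setT (\1_[set w | X w <= x] : T -> R).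
  by apply: measurable_indic; exact: measurable_not_exceed.
have mC : measurable [set w | x < C w].
  rewrite (_ : [set w | _] = ~` \bigcup_k ([set w | K w = k] `&` [set w | X w <= x] `&`
      \bigcap_(j in `I_k) [set w | Xs j w <= x])); last first.
    apply/seteqP; split=> w /=.
      move=> xC [k _ [[/= <- Xx] h]].
      by move: xC; rewrite ltNge => /negP; apply; apply/cluster_max_leP.
    move=> h; rewrite ltNge; apply/negP => /cluster_max_leP[Xx hj].
    by apply: h; exists (K w).
  apply: measurableC; apply: bigcup_measurable => k _; apply: measurableI.
    apply: measurableI; [exact: measurable_offspring_eq | exact: measurable_not_exceed].
  apply: bigcap_measurableType => j _.
  by apply: measurable_not_exceed; exact: measurable_funPT.
pose g w : \bar R := (\1_[set w | (X w <= x)%R] w * (1 - p x) ^+ K w)%:E.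
pose h w : \bar R := (\1_[set w | (X w <= x)%R] w * \sum_(i < K w) (1 - p x) ^+ i)%:E.
have g0 w : (0 <= g w)%E by rewrite lee_fin mulr_ge0 ?exprn_ge0.
have h0 w : (0 <= h w)%E.
  by rewrite lee_fin mulr_ge0 // sumr_ge0 // => i _; rewrite exprn_ge0.
have mg : measurable_fun [set: T] g.
  apply/measurable_EFinP; apply: measurable_funM => //.
  exact: (measurable_offspring_fun (fun k => (1 - p x) ^+ k)).
have mh : measurable_fun [set: T] h.
  apply/measurable_EFinP; apply: measurable_funM => //.
  exact: (measurable_offspring_fun (fun k => \sum_(i < k) (1 - p x) ^+ i)).
have split_indic : ((p x)%:E * \int[P]_w h w + \int[P]_w g w = (1 - p x)%:E)%E.
  rewrite -ge0_integralZl ?lee_fin //.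
  rewrite -ge0_integralD //; last 2 first.
  - by move=> w _; rewrite mule_ge0.
  - by apply: emeasurable_funM => //; exact: measurable_cst.
  rewrite -prob_not_exceed -[in RHS](setIT [set w | X w <= x]).
  rewrite -integral_indic //; last exact: measurable_not_exceed.
  apply: eq_integral => w _; rewrite /g /h -EFinM -EFinD; congr EFin.
  have := subrX1 (1 - p x) (K w); set S := \sum_(_ < _) _; set I := \1__ _.
  set Fk := _ ^+ _ => e.
  by rewrite (_ : p x * (I * S) = - I * (Fk - 1)); [ring | rewrite e; ring].
have gfin : (\int[P]_w g w)%E \is a fin_num.
  rewrite -prob_cluster_max_le; apply: fin_num_measure.
  rewrite (_ : [set w | _] = ~` [set w | x < C w]); first exact: measurableC.
  by apply/seteqP; split => w /=; rewrite leNgt => /negP.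
have complement : (tail P C x + \int[P]_w g w = 1)%E.
  rewrite -prob_cluster_max_le.
  rewrite (_ : [set w | C w <= x] = ~` [set w | x < C w]); last first.
    by apply/seteqP; split => w /=; rewrite leNgt => /negP.
  by rewrite probability_setC // addeCA subee ?adde0 // fin_num_measure.
rewrite -[LHS](addeK _ gfin) complement; apply/esym.
rewrite -[LHS](addeK _ gfin); congr (_ - _)%E.
rewrite muleDr //.
by rewrite mule1 -addeA split_indic -EFinD addrC subrK.
Qed.

End ClusterTail.

(** * First-order asymptotics of the cluster maximum *)

Lemma cvg_geometric_sum1 (R : realType) (I : Type) (F : set_system I) {FF : Filter F}
    (p : I -> R) (k : nat) :
  p i @[i --> F] --> (0 : R) -> \sum_(j < k) (1 - p i) ^+ j @[i --> F] --> (k%:R : R).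
Proof.
move=> p0.
have pow j : (1 - p i) ^+ j @[i --> F] --> (1 : R).
  elim: j => [|j IH]; first by under eq_fun do rewrite expr0; exact: cvg_cst.
  under eq_fun do rewrite exprS.
  suff : (1 - p i) * (1 - p i) ^+ j @[i --> F] --> ((1 - 0) * 1 : R) by rewrite subr0 mulr1.
  by apply: cvgM => //; apply: cvgB => //; exact: cvg_cst.
elim: k => [|k IH]; first by under eq_fun do rewrite big_ord0; exact: cvg_cst.
by under eq_fun do rewrite big_ord_recr; rewrite -natr1; exact: cvgD.
Qed.

Section OffspringFactor.
Context {R : realType} {d} {T : measurableType d} (P : probability T R).
Context (X : T -> R) (mX : measurable_fun setT X) (K : {RV P >-> nat}).
Context (EK_lty : ('E_P[fun w => (K w)%:R] < +oo)%E).

Local Notation p := (rtail P X).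
Local Notation EK := ('E_P[fun w => (K w)%:R] : \bar R)%E.

Lemma mean_offspring_fin : EK \is a fin_num.
Proof. by rewrite ge0_fin_numE // expectation_ge0. Qed.

Lemma offspring_term_ge0 x w :
  0 <= \1_[set w | X w <= x] w * \sum_(i < K w) (1 - p x) ^+ i.
Proof.
rewrite mulr_ge0 // sumr_ge0 // => i _.
by rewrite exprn_ge0 // subr_ge0 rtail_le1.
Qed.

Lemma offspring_term_le x w :
  \1_[set w | X w <= x] w * \sum_(i < K w) (1 - p x) ^+ i <= (K w)%:R.
Proof.
have F01 : 0 <= 1 - p x <= 1.
  by rewrite subr_ge0 rtail_le1 // gerBl rtail_ge0.
have : \sum_(i < K w) (1 - p x) ^+ i <= (K w)%:R.
  rewrite -[X in _ <= X%:R]card_ord -sumr_const; apply: ler_sum => i _.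
  by case/andP: F01 => ? ?; exact: exprn_ile1.
by rewrite indicE; case: (w \in _); rewrite ?mul1r ?mul0r.
Qed.

Lemma measurable_offspring_term x : measurable_fun [set: T]
  (fun w => (\1_[set w | X w <= x] w * \sum_(i < K w) (1 - p x) ^+ i)%:E).
Proof.
apply/measurable_EFinP; apply: measurable_funM.
  by apply: measurable_indic; exact: measurable_not_exceed.
exact: (measurable_offspring_fun _ K (fun k => \sum_(i < k) (1 - p x) ^+ i)).
Qed.

Lemma measurable_offspring_real : measurable_fun [set: T] (fun w => ((K w)%:R%:E : \bar R)).
Proof.
by apply/measurable_EFinP; exact: (measurable_offspring_fun _ K (fun k => k%:R)).
Qed.

Lemma offspring_factor_fin x : offspring_factor P X K x \is a fin_num.
Proof.
rewrite ge0_fin_numE; last by apply: integral_ge0 => w _; rewrite lee_fin offspring_term_ge0.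
apply: le_lt_trans EK_lty; rewrite unlock; apply: ge0_le_integral => //.
- by move=> w _; rewrite lee_fin offspring_term_ge0.
- exact: measurable_offspring_term.
- exact: measurable_offspring_real.
- by move=> w _; rewrite lee_fin offspring_term_le.
Qed.

(** Dominated convergence along an arbitrary sequence of levels: for a fixed
    outcome the indicator is eventually 1 and the sum tends to [K], which also
    bounds it. *)
Lemma offspring_factor_cvg : fine (offspring_factor P X K x) @[x --> +oo] --> fine EK.
Proof.
apply/cvg_pinftyP => u uoo; apply: fine_cvg; rewrite fineK ?mean_offspring_fin //.
rewrite unlock.
have p0 : p (u n) @[n --> \oo] --> 0.
  exact: (cvg_comp u p uoo (rtail_cvg0 P X mX)).
have [] := @dominated_convergence _ T R P setT measurableT
  (fun n w => (\1_[set w | X w <= u n] w * \sum_(i < K w) (1 - p (u n)) ^+ i)%:E)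
  (fun w => (K w)%:R%:E) (fun w => (K w)%:R%:E) _ _ _ _ _ => //.
- by move=> n; exact: measurable_offspring_term.
- exact: measurable_offspring_real.
- apply: aeW => w _; apply: cvg_EFin; first exact: nearW.
  apply: (@cvg_trans _ (\sum_(i < K w) (1 - p (u n)) ^+ i @[n --> \oo])); last first.
    exact: cvg_geometric_sum1.
  apply: near_eq_cvg; near=> n; rewrite /= indicE mem_set ?mul1r //=.
  by apply: ltW; near: n; exact: cvgry_gt.
- apply/integrableP; split; first exact: measurable_offspring_real.
  under eq_integral do rewrite gee0_abs ?lee_fin //.
  by move: EK_lty; rewrite unlock.
- by apply: aeW => w n _; rewrite gee0_abs lee_fin ?offspring_term_ge0 // offspring_term_le.
Unshelve. all: by end_near. Qed.

End OffspringFactor.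

(** The common factor [p] is cancelled wherever it does not vanish, and where it
    vanishes both functions do. *)
Lemma asymp_equiv_common_factor (R : realType) (p e : R -> R) (m : R) :
  0 <= m -> e x @[x --> +oo] --> m ->
  asymp_equiv (fun x => (p x * (1 + e x))%:E) (fun x => ((1 + m) * p x)%:E).
Proof.
move=> m0 em.
have m1 : 1 + m != 0 by rewrite gt_eqF // ltr_wpDr.
have ratio : (1 + e x) / (1 + m) @[x --> +oo] --> (1 : R).
  suff : (1 + e x) / (1 + m) @[x --> +oo] --> ((1 + m) / (1 + m) : R) by rewrite divff.
  apply: cvgM; last exact: cvg_cst.
  by apply: cvgD => //; exact: cvg_cst.
apply/cvgrPdist_lt => eps eps0; near=> x.
have [->|px0] := eqVneq (p x) 0.
  by rewrite mul0r mulr0 !eqxx /= subrr normr0.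
rewrite !eqe [X in _ && X]mulf_eq0 (negbTE m1) (negbTE px0) andbF /=.
have -> : p x * (1 + e x) / ((1 + m) * p x) = (1 + e x) / (1 + m).
  by field; rewrite px0 m1.
by near: x; exact: cvgr_dist_lt.
Unshelve. all: by end_near. Qed.

(** * From the norming sequence to all levels *)

Section TimeChange.
Context {R : realType} (U : R -> R) (alpha : R) (alpha_gt0 : 0 < alpha).
Context (U_gt0 : forall x, 0 < U x).
Context (U_nincr : forall x y, x <= y -> U y <= U x).
Context (U_cvg0 : U x @[x --> +oo] --> 0).
Context (U_ratio : forall t, 0 < t -> U (t * x) / U x @[x --> +oo] --> t `^ (- alpha)).
Context (a : nat -> R) (a_norming : n%:R * U (a n) @[n --> \oo] --> (1 : R)).

(** At a nonpositive [a n] the tail is at least [U 0 > 0], and then [n * U (a n)]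
    would be unbounded. *)
Lemma norming_gt0 : \forall n \near \oo, 0 < a n.
Proof.
near=> n; rewrite ltNge; apply/negP => an0.
have : n%:R * U (a n) < 2 by near: n; apply: cvgr_lt a_norming _ _; rewrite ltr1n.
have : 2 / U 0 < n%:R by near: n; exact: nbhs_infty_gtr.
rewrite ltr_pdivrMr // => h1 h2.
have : n%:R * U 0 <= n%:R * U (a n) by rewrite ler_wpM2l // U_nincr.
by lra.
Unshelve. all: by end_near. Qed.

(** An asymptotic inverse of the norming sequence: [a (clock y)] is equivalent to
    [y], which is all that is needed to read off bounds at level [y]. *)
Definition clock y : nat := Num.truncn (U y)^-1.

Lemma clock_cvg : (clock y)%:R * U y @[y --> +oo] --> (1 : R).
Proof.
apply: (@squeeze_cvgr _ _ _ _ (fun y => 1 - U y) (fun _ => 1)).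
- apply: nearW => y.
  have /truncn_itv/andP[lo up] : 0 <= (U y)^-1 by rewrite invr_ge0 ltW.
  rewrite /clock -[X in _ && X]ler_pdivlMr // mul1r lo andbT.
  by move: up; rewrite -natr1 -[X in X < _]mul1r ltr_pdivrMr // mulrDl mul1r; lra.
- suff : 1 - U y @[y --> +oo] --> (1 - 0 : R) by rewrite subr0.
  by apply: cvgB => //; exact: cvg_cst.
- exact: cvg_cst.
Qed.

Lemma clock_infty : clock y @[y --> +oo] --> \oo.
Proof.
apply/cvgnyPge => m; near=> y.
rewrite /clock truncn_ge_nat ?invr_ge0 ?(ltW (U_gt0 _)) //.
have : U y < (m.+1%:R)^-1.
  by near: y; apply: cvgr_lt U_cvg0 _ _; rewrite invr_gt0.
move=> Um; rewrite (@le_trans _ _ m.+1%:R) // ?ler_nat //.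
by rewrite -[X in X <= _]invrK lef_pV2 ?posrE ?invr_gt0 // ltW.
Unshelve. all: by end_near. Qed.

Lemma clock_norming : (clock y)%:R * U (a (clock y)) @[y --> +oo] --> (1 : R).
Proof. exact: cvg_comp clock_infty a_norming. Qed.

Lemma clock_scaled t : 0 < t ->
  (clock y)%:R * U (t * y) @[y --> +oo] --> t `^ (- alpha).
Proof.
move=> t0.
suff : ((clock y)%:R * U y) * (U (t * y) / U y) @[y --> +oo] --> 1 * t `^ (- alpha).
  rewrite mul1r; apply: cvg_trans; apply: near_eq_cvg; apply: nearW => y.
  by field; rewrite gt_eqF.
by apply: cvgM; [exact: clock_cvg | exact: U_ratio].
Qed.

(** If [a (clock y)] exceeded [k * y], then [clock y * U (a (clock y))], which tends
    to 1, would be at most [clock y * U (k * y)], which tends to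
    [k `^ (- alpha) < 1]. *)
Lemma norming_clock_lt k : 1 < k -> \forall y \near +oo, a (clock y) < k * y.
Proof.
move=> k1; have k0 : 0 < k by lra.
have kalpha : k `^ (- alpha) < 1.
  by rewrite -[X in _ < X](powRr0 k) gt1_ltr_powR // oppr_lt0.
pose m := (k `^ (- alpha) + 1) / 2.
near=> y; rewrite ltNge; apply/negP => kya.
have : (clock y)%:R * U (k * y) < m.
  by near: y; apply: cvgr_lt (clock_scaled _ k0) _ _; rewrite /m; lra.
have : m < (clock y)%:R * U (a (clock y)).
  by near: y; apply: cvgr_gt clock_norming _ _; rewrite /m; lra.
have : (clock y)%:R * U (a (clock y)) <= (clock y)%:R * U (k * y).
  by rewrite ler_wpM2l // U_nincr.
by lra.
Unshelve. all: by end_near. Qed.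

Lemma norming_clock_gt k : 0 < k -> k < 1 -> \forall y \near +oo, k * y < a (clock y).
Proof.
move=> k0 k1.
have kalpha : 1 < k `^ (- alpha).
  rewrite powRN -powRVl ?ltW //.
  by rewrite -[X in X < _](powRr0 k^-1) gt1_ltr_powR // invf_gt1.
pose m := (k `^ (- alpha) + 1) / 2.
near=> y; rewrite ltNge; apply/negP => kya.
have : m < (clock y)%:R * U (k * y).
  by near: y; apply: cvgr_gt (clock_scaled _ k0) _ _; rewrite /m; lra.
have : (clock y)%:R * U (a (clock y)) < m.
  by near: y; apply: cvgr_lt clock_norming _ _; rewrite /m; lra.
have : (clock y)%:R * U (k * y) <= (clock y)%:R * U (a (clock y)).
  by rewrite ler_wpM2l // U_nincr.
by lra.
Unshelve. all: by end_near. Qed.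

Context (Q : R -> R) (Q_nincr : forall x y, x <= y -> Q y <= Q x).
Context (eta J : R) (eta_gt1 : 1 < eta) (J_gt0 : 0 < J).
Context (Q_upper : \forall n \near \oo, n%:R * Q (eta * a n) <= J * eta).
Context (Q_lower : \forall n \near \oo, J / eta <= n%:R * Q (a n)).

(** For [x = eta ^ 2 * y] and [n = clock y] one has [eta * a n <= x], so the bound
    on [n * Q (eta * a n)] applies, while [n * U x] tends to
    [eta `^ (- 2 * alpha)].  The spare factors [eta] absorb the limits. *)
Lemma tail_quotient_le :
  \forall x \near +oo, Q x / U x <= J * (eta ^+ 2 * (eta `^ alpha) ^+ 2).
Proof.
have eta0 : 0 < eta := lt_trans ltr01 eta_gt1.
have b0 : 0 < eta `^ alpha by exact: powR_gt0.
have eta20 : 0 < eta ^+ 2 by rewrite exprn_gt0.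
suff h : \forall y \near +oo, Q (eta ^+ 2 * y) / U (eta ^+ 2 * y) <=
    J * (eta ^+ 2 * (eta `^ alpha) ^+ 2).
  have [M [_ hM]] := h; exists (eta ^+ 2 * M); split; first exact: num_real.
  move=> x Mx; have := hM (x / eta ^+ 2).
  by rewrite ltr_pdivlMr // mulrC Mx [X in Q X](_ : _ = x) ?[X in U X](_ : _ = x);
    [exact|field; rewrite gt_eqF|field; rewrite gt_eqF].
near=> y.
have an : a (clock y) < eta * y by near: y; exact: norming_clock_lt.
have nQ : (clock y)%:R * Q (eta * a (clock y)) <= J * eta.
  by near: y; exact: (clock_infty _ Q_upper).
have nU : (eta * (eta `^ alpha) ^+ 2)^-1 < (clock y)%:R * U (eta ^+ 2 * y).
  near: y; apply: cvgr_gt (clock_scaled _ eta20) _ _.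
  have -> : (eta ^+ 2) `^ (- alpha) = ((eta `^ alpha) ^+ 2)^-1.
    by rewrite powRN !expr2 powRM // ltW.
  by rewrite ltf_pV2 ?posrE ?mulr_gt0 ?exprn_gt0 // ltr_pMl ?exprn_gt0.
have QQ : Q (eta ^+ 2 * y) <= Q (eta * a (clock y)).
  by apply: Q_nincr; rewrite expr2 -mulrA ler_pM2l // ltW.
rewrite ler_pdivrMr //.
have n0 : 0 < (clock y)%:R :> R.
  rewrite lt_neqAle ler0n andbT eq_sym; apply/eqP => n0.
  by move: nU; rewrite n0 mul0r invr_lt0 ltNge mulr_ge0 ?exprn_ge0 ?ltW.
move: an nQ nU QQ n0; set n := clock y => an nQ nU QQ n0.
rewrite -(ler_pM2l n0) (le_trans (ler_wpM2l (ltW n0) QQ)) // (le_trans nQ) //.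
rewrite (_ : n%:R * _ = J * eta * ((eta * (eta `^ alpha) ^+ 2) * (n%:R * U (eta ^+ 2 * y)))); last by ring.
rewrite ler_peMr ?mulr_ge0 ?ltW //.
by rewrite -ltr_pdivrMl ?mulr1 // mulr_gt0 // exprn_gt0.
Unshelve. all: by end_near. Qed.

(** For [x = y / eta] and [n = clock y] one has [x < a n], so the bound on
    [n * Q (a n)] applies, while [n * U x] tends to [eta `^ alpha]. *)
Lemma tail_quotient_ge :
  \forall x \near +oo, J / (eta ^+ 2 * eta `^ alpha) <= Q x / U x.
Proof.
have eta0 : 0 < eta := lt_trans ltr01 eta_gt1.
have b0 : 0 < eta `^ alpha by exact: powR_gt0.
have ieta0 : 0 < eta^-1 by rewrite invr_gt0.
suff h : \forall y \near +oo, J / (eta ^+ 2 * eta `^ alpha) <=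
    Q (eta^-1 * y) / U (eta^-1 * y).
  have [M [_ hM]] := h; exists (eta^-1 * M); split; first exact: num_real.
  move=> x Mx; have := hM (eta * x).
  by rewrite -ltr_pdivrMl // Mx mulKf ?gt_eqF //; exact.
near=> y.
have an : eta^-1 * y < a (clock y).
  by near: y; apply: norming_clock_gt => //; rewrite invf_lt1.
have nQ : J / eta <= (clock y)%:R * Q (a (clock y)).
  by near: y; exact: (clock_infty _ Q_lower).
have nU : (clock y)%:R * U (eta^-1 * y) < eta * eta `^ alpha.
  near: y; apply: cvgr_lt (clock_scaled _ ieta0) _ _.
  by rewrite powRN -powRVl ?ltW // invrK ltr_pMl.
have QQ : Q (a (clock y)) <= Q (eta^-1 * y) by apply: Q_nincr; exact: ltW.
rewrite ler_pdivlMr //.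
have n0 : 0 < (clock y)%:R :> R.
  rewrite lt_neqAle ler0n andbT eq_sym; apply/eqP => n0.
  by move: nQ; rewrite n0 mul0r leNgt divr_gt0.
move: an nQ nU QQ n0; set n := clock y => an nQ nU QQ n0.
rewrite -(ler_pM2l n0) (le_trans _ (ler_wpM2l (ltW n0) QQ)) // (le_trans _ nQ) //.
rewrite (_ : n%:R * _ = J / eta * ((n%:R * U (eta^-1 * y)) / (eta * eta `^ alpha))); last first.
  by field; rewrite !gt_eqF.
by rewrite ler_piMr ?divr_ge0 ?ltW // ltr_pdivrMr ?mul1r // mulr_gt0.
Unshelve. all: by end_near. Qed.

End TimeChange.

(** * A test function for the first coordinate *)

Section Ramp.
Context {R : realType} (eta : R) (eta_gt1 : 1 < eta).

Definition ramp (s : R) : R := Num.min 1 (Num.max 0 ((s - 1) / (eta - 1))).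

Lemma ramp_ge0 s : 0 <= ramp s.
Proof. by rewrite le_min ler01 le_max lexx. Qed.

Lemma ramp_le1 s : ramp s <= 1.
Proof. by rewrite ge_min lexx. Qed.

Lemma ramp_gt0 s : (0 < ramp s) = (1 < s).
Proof.
by rewrite lt_min ltr01 lt_max ltxx /= pmulr_lgt0 ?invr_gt0 subr_gt0.
Qed.

Lemma ramp_eq0 s : s <= 1 -> ramp s = 0.
Proof.
by move=> s1; apply/eqP; rewrite eq_le ramp_ge0 andbT leNgt ramp_gt0 -leNgt.
Qed.

Lemma ramp_eq1 s : eta <= s -> ramp s = 1.
Proof.
move=> es; have e1 : 0 < eta - 1 by rewrite subr_gt0.
by rewrite /ramp min_l // le_max ler_pdivlMr // mul1r lerB // orbT.
Qed.

Lemma continuous_ramp : continuous ramp.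
Proof.
move=> s; apply: (@continuous_min R R (fun=> 1) (fun s => Num.max 0 ((s - 1) / (eta - 1))) s).
  exact: cvg_cst.
apply: (@continuous_max R R (fun=> 0) (fun s => (s - 1) / (eta - 1)) s).
  exact: cvg_cst.
by apply: cvgM; [apply: cvgB; [exact: cvg_id|exact: cvg_cst]|exact: cvg_cst].
Qed.

Lemma measurable_ramp : measurable_fun setT ramp.
Proof. by apply: continuous_measurable_fun; exact: continuous_ramp. Qed.

Lemma vague_test_ramp : vague_test (fun z : R * R => ramp z.1).
Proof.
split.
- move=> z; apply: (@continuous_comp _ _ _ fst ramp); first exact: cvg_fst.
  exact: continuous_ramp.
- by move=> z; exact: ramp_ge0.
- by exists 1 => z; exact: ramp_le1.
- exists 1 => // z /= /eqP z1; rewrite (@le_trans _ _ `|z.1|) //.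
    apply: le_trans (ler_norm _); rewrite leNgt; apply/negP => /ltW z1'.
    by apply: z1; exact: ramp_eq0.
  by rewrite prod_normE le_max lexx.
Qed.

Lemma ramp_mass_fin (mu : {measure set (R * R) -> \bar R}) :
  radon_punctured mu -> (\int[mu]_z (ramp z.1)%:E < +oo)%E.
Proof.
move=> [_ fin_mu].
have mB : measurable [set z : R * R | 1 < z.1].
  rewrite (_ : [set z | _] = fst @^-1` `]1, +oo[); last first.
    by apply/seteqP; split => z /=; rewrite in_itv /= andbT.
  by rewrite -[X in measurable X]setTI; exact: measurable_fst.
apply: (@le_lt_trans _ _ (mu [set z : R * R | 1 < z.1])); last first.
  apply: fin_mu => //; exists 1 => // z /= z1.
  by rewrite prod_normE le_max (le_trans (ltW z1)) // ler_norm.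
rewrite -[X in (_ <= mu X)%E]setIT -integral_indic //; apply: ge0_le_integral => //.
- by move=> z _; rewrite lee_fin ramp_ge0.
- apply/measurable_EFinP; apply: measurableT_comp => //; exact: measurable_ramp.
- exact/measurable_EFinP/measurable_indic.
- move=> z _; rewrite lee_fin indicE; have [z1|z1] := boolP (z \in _).
    exact: ramp_le1.
  rewrite ramp_eq0 // leNgt; apply/negP => h; move/negP: z1; apply.
  by rewrite inE.
Qed.

(** The ramp is positive exactly where the first coordinate exceeds 1, so if its
    integral vanished, that half plane would be null. *)
Lemma ramp_mass_gt0 (mu : {measure set (R * R) -> \bar R}) :
  (0 < mu [set z | [/\ 0 <= z.1, 0 <= z.2, z != 0 & 1 < z.1]%R])%E ->
  (0 < \int[mu]_z (ramp z.1)%:E)%E.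
Proof.
move=> B_gt0; rewrite lt_neqAle integral_ge0 ?andbT => [|z _]; last first.
  by rewrite lee_fin ramp_ge0.
apply/eqP => int0.
have mr : measurable_fun setT (fun z : R * R => (ramp z.1)%:E).
  apply/measurable_EFinP; apply: measurableT_comp => //; exact: measurable_ramp.
have /(ae_eq_integral_abs mu measurableT mr) ae0 :
    (\int[mu]_(z in setT) `|(ramp z.1)%:E| = 0)%E.
  by rewrite [RHS]int0; apply: eq_integral => z _; rewrite gee0_abs ?lee_fin ?ramp_ge0.
have [N [mN N0 sN]] := ae0.
move: B_gt0; rewrite ltNge => /negP; apply.
rewrite -N0; apply: le_measure; rewrite ?inE //; last first.
  move=> z [_ _ _ z1]; apply: sN => /= /(_ I) [r0].
  by move: z1; rewrite -ramp_gt0 r0 ltxx.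
rewrite (_ : [set z | _] = `]1, +oo[%classic `*` `[0, +oo[%classic).
  exact: measurableX.
apply/seteqP; split => z /=; rewrite !in_itv /= !andbT.
  by move=> [].
move=> [z1 z2]; split => //; first by rewrite (le_trans ler01) // ltW.
by apply/eqP => z0; move: z1; rewrite z0 /= ltNge ler01.
Qed.

End Ramp.

(** * Regular variation of the first coordinate *)

(** The set function on the left is the image measure of [P] under [g] scaled by
    [n]: the two are convertible, which makes the change of variables available. *)
Lemma integral_scaled_law d (T : measurableType d) d' (S : measurableType d')
    (R : realType) (P : probability T R) (g : T -> S) (n : nat) (phi : S -> R) :
  measurable_fun setT g -> measurable_fun setT phi -> (forall z, 0 <= phi z) ->
  (\int[fun B : set S => n%:R%:E * P [set w | B (g w)]]_z (phi z)%:E =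
   n%:R%:E * \int[P]_w (phi (g w))%:E)%E.
Proof.
move=> mg mphi phi0.
pose r : {nonneg R} := NngNum (ler0n R n).
have -> : (fun B : set S => n%:R%:E * P [set w | B (g w)])%E =
    mscale r (pushforward P g) by [].
rewrite ge0_integral_mscale //=; last 2 first.
- exact/measurable_EFinP.
- by move=> z _; rewrite lee_fin.
congr (_ * _)%E; rewrite ge0_integral_pushforward //.
- exact/measurable_EFinP.
- by move=> z _; rewrite lee_fin.
Qed.

Section FirstCoordinate.
Context {R : realType} {d} {T : measurableType d} (P : probability T R).
Context (X Y : T -> R) (alpha : R) (mu : {measure set (R * R) -> \bar R}).
Context (XY_rv : regularly_varying_vec P (fun w => (X w, Y w)) alpha mu).
Context (mu_gt0 : (0 < mu [set z | [/\ 0 <= z.1, 0 <= z.2, z != 0 & 1 < z.1]%R])%E).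

Let mX : measurable_fun setT X.
Proof. by have [/measurable_fun_pairP[]] := XY_rv. Qed.

Let mY : measurable_fun setT Y.
Proof. by have [/measurable_fun_pairP[]] := XY_rv. Qed.

Lemma ramp_mean_le (eta c : R) : 1 < eta -> 0 < c ->
  (\int[P]_w (ramp eta (c^-1 * X w))%:E <= (rtail P X c)%:E)%E.
Proof.
move=> eta1 c0; rewrite -tailE // -[X in (_ <= P X)%E]setIT.
have mc := measurable_exceed X mX c.
rewrite -integral_indic //; apply: ge0_le_integral => //.
- by move=> w _; rewrite lee_fin ramp_ge0.
- apply/measurable_EFinP; apply: measurableT_comp; first exact: measurable_ramp.
  by apply: measurable_funM => //; exact: measurable_cst.
- exact/measurable_EFinP/measurable_indic.
- move=> w _; rewrite lee_fin indicE; have [|] := boolP (w \in _).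
    by rewrite ramp_le1.
  move=> /negP wc; rewrite ramp_eq0 // ler_pdivrMl // mulr1 leNgt.
  by apply/negP => cX; apply: wc; rewrite inE.
Qed.

Lemma ramp_mean_ge (eta c : R) : 1 < eta -> 0 < c ->
  ((rtail P X (eta * c))%:E <= \int[P]_w (ramp eta (c^-1 * X w))%:E)%E.
Proof.
move=> eta1 c0; rewrite -tailE // -[X in (P X <= _)%E]setIT.
have mc := measurable_exceed X mX (eta * c).
rewrite -integral_indic //; apply: ge0_le_integral => //.
- exact/measurable_EFinP/measurable_indic.
- apply/measurable_EFinP; apply: measurableT_comp; first exact: measurable_ramp.
  by apply: measurable_funM => //; exact: measurable_cst.
- move=> w _; rewrite lee_fin indicE; have [|] := boolP (w \in _); last first.
    by rewrite ramp_ge0.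
  by rewrite inE /= => cX; rewrite ramp_eq1 // ler_pdivlMl // mulrC ltW.
Qed.

(** The quotient of the tail of [X] by the tail of the norm is slowly varying, by
    [ratio_cvg1_of_bounds] applied to the bounds of [tail_quotient_ge] and
    [tail_quotient_le], in which [eta] is free. *)
Lemma first_tail_ratio : 0 < alpha ->
  (\forall x \near +oo, 0 < rtail P X x) /\
  forall t, 0 < t -> rtail P X (t * x) / rtail P X x @[x --> +oo] --> t `^ (- alpha).
Proof.
move=> alpha0; have [_ mu_radon _ [N normN [rvN [a na1 va]]]] := XY_rv.
set Z := _ \o _ in rvN na1; set U := rtail P Z; set Q := rtail P X.
have [mZ _ _ _] := rvN.
have U_gt0 x : 0 < U x by apply: rtail_gt0 => //; exact: regvar_rtail_gt0 rvN.
have U_nincr x y : x <= y -> U y <= U x by exact: rtail_nincr.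
have Q_nincr x y : x <= y -> Q y <= Q x by exact: rtail_nincr.
have U_ratio := regvar_rtail_ratio _ _ _ rvN.
have U_cvg0 : U x @[x --> +oo] --> 0 by exact: rtail_cvg0.
have norming : n%:R * U (a n) @[n --> \oo] --> (1 : R).
  move: na1; under eq_fun do rewrite tailE // -EFinM.
  by move/fine_cvg.
have bounds eta : 1 < eta -> exists2 J : R, 0 < J & \forall x \near +oo,
    J <= Q x / U x <= (eta ^+ 4 * (eta `^ alpha) ^+ 3) * J.
  move=> eta1.
  pose J := fine (\int[mu]_z (ramp eta z.1)%:E)%E.
  have J_fin : (\int[mu]_z (ramp eta z.1)%:E)%E = J%:E.
    rewrite fineK // ge0_fin_numE; first exact: ramp_mass_fin.
    by apply: integral_ge0 => z _; rewrite lee_fin ramp_ge0.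
  have J_gt0 : 0 < J by rewrite -lte_fin -J_fin; exact: ramp_mass_gt0.
  have W_cvg : (n%:R%:E * \int[P]_w (ramp eta ((a n)^-1 * X w))%:E)%E
      @[n --> \oo] --> J%:E.
    rewrite -J_fin; have := va _ (vague_test_ramp _ eta1).
    apply: cvg_trans; apply: near_eq_cvg; apply: nearW => n.
    rewrite (@integral_scaled_law _ _ _ _ _ P
      (fun w => (a n)^-1 *: ((X w, Y w) : R * R)) n (fun z => ramp eta z.1)) //.
    - apply/measurable_fun_pairP; split;
        by apply: measurable_funM => //; exact: measurable_cst.
    - by apply: measurableT_comp => //; exact: measurable_ramp.
    - by move=> z; exact: ramp_ge0.
  have eta0 : 0 < eta := lt_trans ltr01 eta1.
  have a_gt0 := norming_gt0 _ U_gt0 U_nincr _ norming.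
  have W_lt : \forall n \near \oo, (n%:R%:E * \int[P]_w (ramp eta ((a n)^-1 * X w))%:E < (J * eta)%:E)%E.
    by apply: (W_cvg _ (open_ereal_lt' _)); rewrite lte_fin ltr_pMr.
  have W_gt : \forall n \near \oo, ((J / eta)%:E < n%:R%:E * \int[P]_w (ramp eta ((a n)^-1 * X w))%:E)%E.
    by apply: (W_cvg _ (open_ereal_gt' _)); rewrite lte_fin gtr_pMr // invf_lt1.
  have Q_upper : \forall n \near \oo, n%:R * Q (eta * a n) <= J * eta.
    near=> n; rewrite -lee_fin EFinM.
    apply: (@le_trans _ _ (n%:R%:E * \int[P]_w (ramp eta ((a n)^-1 * X w))%:E)%E).
      rewrite lee_pmul ?lee_fin ?rtail_ge0 // ramp_mean_ge //.
      by near: n.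
    by apply: ltW; near: n.
  have Q_lower : \forall n \near \oo, J / eta <= n%:R * Q (a n).
    near=> n; rewrite -lee_fin [leRHS]EFinM.
    apply: (@le_trans _ _ (n%:R%:E * \int[P]_w (ramp eta ((a n)^-1 * X w))%:E)%E).
      by apply: ltW; near: n.
    rewrite lee_pmul ?lee_fin ?ler0n //.
      by apply: integral_ge0 => w _; rewrite lee_fin ramp_ge0.
    by apply: ramp_mean_le => //; near: n.
  have b0 : 0 < eta `^ alpha by exact: powR_gt0.
  exists (J / (eta ^+ 2 * eta `^ alpha)).
    by rewrite divr_gt0 // mulr_gt0 // exprn_gt0.
  near=> x; apply/andP; split.
    by near: x; exact: (tail_quotient_ge _ _ alpha0 U_gt0 U_nincr U_cvg0 U_ratio
      _ norming _ Q_nincr _ _ eta1 J_gt0 Q_lower).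
  rewrite (_ : _ * (J / _) = J * (eta ^+ 2 * (eta `^ alpha) ^+ 2)); last first.
    by field; rewrite !gt_eqF.
  by near: x; exact: (tail_quotient_le _ _ alpha0 U_gt0 U_nincr U_cvg0 U_ratio
    _ norming _ Q_nincr _ _ eta1 J_gt0 Q_upper).
split.
  have [J J0 QJ] := bounds 2 ltac:(lra).
  near=> x; have /andP[JQ _] : J <= Q x / U x <= (2 ^+ 4 * (2 `^ alpha) ^+ 3) * J.
    by near: x.
  by rewrite -[Q x](divfK (lt0r_neq0 (U_gt0 x))) mulr_gt0 // (lt_le_trans J0).
move=> t t0.
have q_cvg : Q (t * x) / U (t * x) / (Q x / U x) @[x --> +oo] --> (1 : R).
  apply: (@ratio_cvg1_of_bounds R (fun x => Q x / U x)) => // k k1.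
  (* eta is chosen so that the width eta ^ (4 + 3 alpha) of the bounds equals k *)
  pose b : R := 4 + 3 * alpha.
  have b0 : 0 < b by rewrite /b; lra.
  have k0 : 0 < k := lt_trans ltr01 k1.
  have eta1 : 1 < k `^ b^-1.
    by rewrite -[X in X < _](powRr0 k) gt1_ltr_powR // invr_gt0.
  have [J J0 QJ] := bounds _ eta1; exists J => //.
  suff -> : k = (k `^ b^-1) ^+ 4 * ((k `^ b^-1) `^ alpha) ^+ 3 by [].
  rewrite -!powR_mulrn ?powR_ge0 // -!powRrM -powRD; last first.
    by rewrite (gt_eqF k0) implybT.
  rewrite -[LHS]powRr1 ?ltW //; congr (_ `^ _).
  by rewrite /b; field; rewrite gt_eqF.
suff : (Q (t * x) / U (t * x) / (Q x / U x)) * (U (t * x) / U x)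
    @[x --> +oo] --> 1 * t `^ (- alpha).
  rewrite mul1r; apply: cvg_trans; apply: near_eq_cvg; apply: nearW => x.
  have U1 := lt0r_neq0 (U_gt0 x); have U2 := lt0r_neq0 (U_gt0 (t * x)).
  have [->|Qx] := eqVneq (Q x) 0; first by rewrite mul0r !invr0 !mulr0 mul0r.
  by field; rewrite Qx U1 U2.
by apply: cvgM => //; exact: U_ratio.
Unshelve. all: by end_near. Qed.

End FirstCoordinate.

(** * The cluster maximum *)

Theorem proposition4p1 (R : realType) (dA d d' : measure_display)
    (mark : measurableType dA) (T : measurableType d) (T' : measurableType d')
    (P : probability T R) (P' : probability T' R)
    (A : {RV P >-> mark}) (f : {mfun mark >-> R}) (f_ge0 : forall a, 0 <= f a)
    (X : T -> R) (X_def : X = f \o A) (K : {RV P >-> nat})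
    (alpha : R) (alpha_gt1 : 1 < alpha) (mu : {measure set (R * R) -> \bar R})
    (XK_rv : regularly_varying_vec P (fun w => (X w, (K w)%:R)) alpha mu)
    (Xs : nat -> {RV P >-> R}) (Xs_copy : forall j, eq_law P (Xs j) P X)
    (indep : mutually_independent P (fun i : option nat =>
       if i is Some j then generated_by (Xs j)
       else generated_by (fun w => (X w, K w))))
    (H : {RV P' >-> R}) (H_law : eq_law P' H P (cluster_max X K Xs)) :
  asymp_equiv (tail P' H)
    (fun x => (1 + 'E_P[fun w => (K w)%:R]) * tail P X x)%E /\
  ((0 < mu [set z | [/\ 0 <= z.1, 0 <= z.2, z != 0 & 1 < z.1]%R])%E ->
   regularly_varying_rv P' H alpha).
Proof.
have mX : measurable_fun setT X.
  by rewrite X_def; apply: measurableT_comp; exact: measurable_funPT.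
have mK := measurable_offspring_fun P K (fun k => k%:R).
have EK_lty : ('E_P[fun w => (K w)%:R] < +oo)%E.
  have [_ _ _ [N normN [rvN _]]] := XK_rv.
  have [c c0 cN] := planar_norm_ge_snd _ normN.
  have [mN _ _ _] := rvN.
  have N0 w : 0 <= (N \o (fun w => (X w, (K w)%:R))) w by exact: planar_norm_ge0.
  have := regvar_mean_lty _ _ _ _ _ _ N0 alpha_gt1 rvN.
  set V := _ \o _ in mN N0 *; move=> EN_lty.
  apply: (@le_lt_trans _ _ ((c^-1)%:E * \int[P]_w (V w)%:E)%E); last first.
    rewrite lte_mul_pinfty // ?lee_fin ?invr_ge0 ?ltW //.
  rewrite unlock -ge0_integralZl //; last 3 first.
  - exact/measurable_EFinP.
  - by move=> w _; rewrite lee_fin.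
  - by rewrite lee_fin invr_ge0 ltW.
  apply: ge0_le_integral => //.
  - exact/measurable_EFinP.
  - by apply: emeasurable_funM; [exact: measurable_cst | exact/measurable_EFinP].
  - move=> w _; rewrite -EFinM lee_fin ler_pdivlMl //.
    by have := cN (X w) (K w)%:R; rewrite normr_nat.
set EK := ('E_P[fun w => (K w)%:R])%E in EK_lty *.
have EK_fin : EK \is a fin_num by exact: mean_offspring_fin.
pose p := rtail P X; pose e x := fine (offspring_factor P X K x).
have EK0 : 0 <= fine EK by rewrite fine_ge0 // expectation_ge0.
have e_cvg : e x @[x --> +oo] --> fine EK by exact: offspring_factor_cvg.
have tailH x : tail P' H x = (p x * (1 + e x))%:E.
  have -> : tail P' H x = tail P (cluster_max X K Xs) x.
    have := H_law `]x, +oo[%classic (measurable_itv _).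
    by congr (P' _ = P _); apply/seteqP; split => w /=; rewrite in_itv /= andbT.
  rewrite (tail_cluster_max P X mX K Xs Xs_copy indep).
  by rewrite EFinM EFinD (fineK (offspring_factor_fin P X mX K EK_lty x)).
split.
  have -> : tail P' H = fun x => (p x * (1 + e x))%:E by exact/funext.
  have -> : (fun x => (1 + EK) * tail P X x)%E = fun x => ((1 + fine EK) * p x)%:E.
    by apply/funext => x; rewrite tailE // EFinM EFinD (fineK EK_fin).
  exact: asymp_equiv_common_factor.
move=> mu_gt0; have alpha0 : 0 < alpha by lra.
have [p_gt0 p_ratio] := first_tail_ratio P X _ _ _ XK_rv mu_gt0 alpha0.
have mH : measurable_fun setT H by exact: measurable_funPT.
have rtailH x : rtail P' H x = p x * (1 + e x) by rewrite /rtail tailH.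
have e1_cvg : 1 + e x @[x --> +oo] --> 1 + fine EK.
  by apply: cvgD => //; exact: cvg_cst.
have EK1 : 0 < 1 + fine EK by rewrite ltr_wpDr.
(* H inherits nonnegativity from the cluster maximum, which is at least X *)
apply: regularly_varying_of_ratio => //.
- exists (H @^-1` `]-oo, 0[); split.
  + by rewrite -[X in measurable X]setTI; exact: mH.
  + rewrite H_law //.
    rewrite (_ : _ @^-1` _ = set0) ?measure0 //.
    apply/seteqP; split => w //=; rewrite in_itv /= ltNge => /negP; apply.
    have [Xle _] := (cluster_max_leP P X K Xs w (cluster_max X K Xs w)).1 (lexx _).
    by apply: le_trans Xle; rewrite X_def /=.
  + by move=> w /= /negP; rewrite -ltNge in_itv.
- near=> x; rewrite rtailH mulr_gt0 //; first by near: x.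
  near: x; exact: cvgr_gt e1_cvg _ EK1.
- move=> t t0; under eq_fun do rewrite !rtailH.
  by apply: (@ratio_cvg_mul R p (fun x => 1 + e x) (1 + fine EK)) => //; exact: p_ratio.
Unshelve. all: by end_near. Qed.
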